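(* Let $\mathbb{K}$ be a field of characteristic zero, let $S=\mathbb{K}[x_1,\dots,x_n]$ with $\mathfrak{m}=(x_1,\dots,x_n)$, and let $I\subset S$ be an artinian monomial ideal generated in degree $d$ with almost linear resolution. Then for a sufficiently general linear form $\ell\in S_1$, $$\mathfrak{m}^d\subseteq I+(\ell)^2 .$$
   Context: $S$ is standard graded. ''Generated in degree $d$'' means that all minimal generators of $I$ are homogeneous of degree $d$. For an ideal $I$ generated in degree $d$, write $\beta_{i,j}(S/I)$ for the graded Betti numbers of $S/I$ over $S$. The minimal free resolution of $S/I$ is linear for $r$ steps if $\beta_{i,i+j}(S/I)=0$ for all $1\le i\le r$ and all $j\ge d$; $S/I$ (or $I$) has almost linear resolution if this holds with $r=n-1$. ''Sufficiently general'' means: for all $\ell$ in some nonempty Zariski-open subset of the space $S_1$ of linear forms. (The statement is the case of artinian monomial ideals with almost linear resolution, $p=n$, of the Eisenbud–Huneke–Ulrich conjecture: if $I\subset S$ is artinian, generated in degree $d$, with resolution linear for $p-1$ steps, then $\mathfrak{m}^d\subseteq I+(l_p,\dots,l_n)^2$ for sufficiently general linear forms $l_p,\dots,l_n$.) *)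

(* Defs.v *)
From mathcomp Require Import all_boot all_order all_algebra.
From mathcomp Require Import classical_sets.
From mathcomp Require Import mpoly.

Set Implicit Arguments.
Unset Strict Implicit.
Unset Printing Implicit Defensive.

Import GRing.Theory.
Local Open Scope ring_scope.
Local Open Scope classical_set_scope.

(* Ideals are plain sets: MathComp's [idealr] only covers proper decidable
   ideals, and is not stable under sums and powers. *)
Section Ideals.
Variable R : comNzRingType.
Implicit Types (A I J : set R).

Definition is_ideal I : Prop :=
  [/\ I 0, forall p q, I p -> I q -> I (p + q) & forall c p, I p -> I (c * p)].

Definition ideal_gen A : set R :=
  [set p | exists (k : nat) (c g : 'I_k -> R),
     (forall i, A (g i)) /\ p = \sum_(i < k) c i * g i].

Definition ideal_add I J : set R := [set p + q | p in I & q in J].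

Definition ideal_mul I J : set R := ideal_gen [set p * q | p in I & q in J].

Definition ideal_exp I (d : nat) : set R := iter d (ideal_mul I) setT.

(* The quotient ring R/I satisfies the descending chain condition on ideals,
   expressed with the ideals of R containing I. *)
Definition artinian_ideal I : Prop :=
  forall J : nat -> set R,
    (forall k, [/\ is_ideal (J k), I `<=` J k & J k.+1 `<=` J k]) ->
    exists N, forall k, (N <= k)%N -> J k = J N.

Definition minimal_generators I (G : seq R) : Prop :=
  I = ideal_gen [set` G] /\
  forall g, g \in G -> ~ ideal_gen [set` rem g G] g.

End Ideals.

Section PolynomialRing.
Variables (K : fieldType) (n : nat).
Local Notation S := {mpoly K[n]}.
Implicit Types (I : set S) (d : nat).

Definition max_ideal : set S := ideal_gen [set 'X_i | i in [set: 'I_n]].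

Definition monomial_ideal I : Prop :=
  exists M : set 'X_{1..n}, I = ideal_gen [set 'X_[m] | m in M].

Definition generated_in_degree d I : Prop :=
  exists G : seq S, minimal_generators I G /\ {in G, forall g, g \is d.-homog}.

(* Finitely generated graded free modules F_i = (+)_k S(-gdeg k), k < rk i,
   whose elements are row vectors, with maps F_(i+1) -> F_i, v |-> v *m dmx i,
   and F_0 -> S/I, v |-> class of the entry of v *m aug. *)
Record free_complex := FreeComplex {
  rk : nat -> nat;
  gdeg : forall i, 'I_(rk i) -> nat;
  dmx : forall i, 'M[S]_(rk i.+1, rk i);
  aug : 'cV[S]_(rk 0)
}.

(* The maps have degree 0. *)
Definition graded_maps (F : free_complex) : Prop :=
  (forall k, aug F k 0 \is (gdeg k).-homog) /\
  (forall i k l m, m \in msupp (dmx F i k l) ->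
     (mdeg m + gdeg l)%N = gdeg k).

(* ... -> F_1 -> F_0 -> S/I -> 0 is exact. *)
Definition exact_resolution I (F : free_complex) : Prop :=
  [/\ forall p : S, exists v : 'rV_(rk F 0), I (p - (v *m aug F) 0 0),
      forall v : 'rV_(rk F 0),
        I ((v *m aug F) 0 0) <-> exists w, v = w *m dmx F 0
    & forall i (v : 'rV_(rk F i.+1)),
        v *m dmx F i = 0 <-> exists w, v = w *m dmx F i.+1].

Definition minimal_free_resolution I (F : free_complex) : Prop :=
  [/\ graded_maps F, exact_resolution I F
    & forall i k l, max_ideal (dmx F i k l)].

(* The number of summands S(-j) of F_i; it is beta_(i,j)(S/I) when F is the
   minimal free resolution of S/I. *)
Definition betti (F : free_complex) (i j : nat) : nat :=
  #|[set k : 'I_(rk F i) | gdeg k == j]%SET|.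

(* The minimal free resolution is unique up to isomorphism, so it does not
   matter which one is considered. *)
Definition linear_for_steps d (r : nat) I : Prop :=
  exists F, minimal_free_resolution I F /\
    forall i j, (1 <= i <= r)%N -> (d <= j)%N -> betti F i (i + j) = 0%N.

Definition almost_linear_resolution d I : Prop := linear_for_steps d n.-1 I.

Definition linear_form (a : 'I_n -> K) : S := \sum_(i < n) a i *: 'X_i.

(* The complement of a common zero locus in the affine space K^n. *)
Definition zariski_open (U : set ('I_n -> K)) : Prop :=
  exists Z : set S, U = [set a | exists2 f, Z f & f.@[a] != 0].

(* Linear forms are parametrised by their coefficients, S_1 = K^n. *)
Definition for_general_linear_form (P : S -> Prop) : Prop :=
  exists U : set ('I_n -> K),
    [/\ zariski_open U, U !=set0 & forall a, U a -> P (linear_form a)].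

End PolynomialRing.

Arguments max_ideal {K n}.

(* Main.v *)
From HB Require Import structures.
Require Import Defs.
From mathcomp Require Import all_boot all_order all_algebra.
From mathcomp Require Import classical_sets boolp.
From mathcomp Require Import mpoly ring zify.

(** Two facts make the theorem true.

    (1) Every monomial of degree at least d that misses one variable x_j lies
    in I ([monomial_missing_var], for n > 1).  Otherwise, I being artinian,
    there is a monomial x^m outside I, of degree at least d and free of x_j,
    such that x_i x^m is in I for all i <> j.  In the Koszul homology of S/I,
    the class of x^m e_1 ... e_n with e_j omitted is then a cycle; it is not a
    boundary, because I is monomial and x^m is not divisible by x_j.  Hence
    Tor_(n-1)(S/I, K) is nonzero in degree mdeg m + n - 1, against the
    linearity of the resolution at step n - 1.  The passage from the cycle to a
    generator of F_(n-1) is done one variable at a time, without Koszul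
    complexes: an element u_k of F_k is replaced by some u_(k+1) with
    x u_k = d u_(k+1) modulo the variables already used
    ([socle_monomial_lift]).  This rests on the exactness of F modulo k
    variables in homological degrees above k ([exact_mod_vars]).

    (2) An ideal J that contains l^2, with l = sum a_i x_i and all a_i nonzero,
    and all monomials of degree d missing x or missing y, contains every
    monomial of degree d ([monomials_mod_square]).  The induction is on the
    degree e in x and y.  Write the monomials of degree e in x, y with a fixed
    cofactor as E_0, ..., E_e.  Modulo monomials of smaller degree in x and y,
    which are in J by induction, l^2 acts as (a_x x + a_y y)^2.  So the E_i
    satisfy, modulo J, a linear recurrence with a double characteristic root
    rho = - a_y / a_x: up to the factor rho^i they form an arithmetic
    progression.  It vanishes at both ends 0 and e, so in characteristic zero
    it vanishes identically ([second_difference_ideal]).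

    The open set of linear forms is the complement of the coordinate
    hyperplanes.  When n = 1 there are no two variables to choose, but the
    only monomial of degree d generates I. *)

Set Implicit Arguments.
Unset Strict Implicit.
Unset Printing Implicit Defensive.

Import GRing.Theory.
Local Open Scope ring_scope.
Local Open Scope classical_set_scope.

(** * Ideals as sets *)

Section IdealFacts.
Variable R : comNzRingType.
Implicit Types (I J : set R).

Lemma ideal_sub I p q : is_ideal I -> I p -> I q -> I (p - q).
Proof. by move=> [_ add mul] Ip Iq; apply: add => //; rewrite -mulN1r; apply: mul. Qed.

Lemma ideal_mulr I p q : is_ideal I -> I p -> I (p * q).
Proof. by move=> [_ _ mul] Ip; rewrite mulrC; apply: mul. Qed.

Lemma ideal_sum I (T : Type) (r : seq T) (P : pred T) (F : T -> R) :
  is_ideal I -> (forall i, P i -> I (F i)) -> I (\sum_(i <- r | P i) F i).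
Proof. by move=> [I0 add _] IF; apply: big_ind. Qed.

Lemma ideal_gen_ideal (A : set R) : is_ideal (ideal_gen A).
Proof.
split.
- by exists 0, (fun=> 0), (fun=> 0); split=> [[]|] //; rewrite big_ord0.
- move=> p q [k [c [g [Ag ->]]]] [k' [c' [g' [Ag' ->]]]].
  exists (k + k')%N,
    (fun i => match split i with inl j => c j | inr j => c' j end),
    (fun i => match split i with inl j => g j | inr j => g' j end).
  split=> [i|]; first by case: (split i).
  rewrite big_split_ord /=; congr (_ + _); apply: eq_bigr => i _.
    by rewrite -/(unsplit (inl i)) unsplitK.
  by rewrite -/(unsplit (inr i)) unsplitK.
- move=> a p [k [c [g [Ag ->]]]]; exists k, (fun i => a * c i), g; split=> //.
  by rewrite mulr_sumr; apply: eq_bigr => i _; rewrite mulrA.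
Qed.

Lemma mem_ideal_gen (A : set R) p : A p -> ideal_gen A p.
Proof.
move=> Ap; exists 1%N, (fun=> 1), (fun=> p); split=> //.
by rewrite big_ord1 mul1r.
Qed.

Lemma ideal_gen_min (A J : set R) :
  is_ideal J -> A `<=` J -> ideal_gen A `<=` J.
Proof.
move=> idJ AJ p [k [c [g [Ag ->]]]]; apply: ideal_sum => // i _.
by case: idJ => _ _; apply; apply: AJ.
Qed.

Lemma ideal_add_ideal I J :
  is_ideal I -> is_ideal J -> is_ideal (ideal_add I J).
Proof.
move=> [I0 addI mulI] [J0 addJ mulJ]; split.
- by exists 0 => //; exists 0 => //; rewrite addr0.
- move=> _ _ [p Ip [q Jq <-]] [p' Ip' [q' Jq' <-]].
  exists (p + p'); first exact: addI.
  by exists (q + q'); [exact: addJ | rewrite addrACA].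
- move=> c _ [p Ip [q Jq <-]]; exists (c * p); first exact: mulI.
  by exists (c * q); [exact: mulJ | rewrite mulrDr].
Qed.

Definition row_in (P : set R) r (v : 'rV[R]_r) := forall k, P (v 0 k).

Variable P : set R.
Hypothesis idP : is_ideal P.

Lemma row_inB r (u v : 'rV_r) : row_in P u -> row_in P v -> row_in P (u - v).
Proof. by move=> Pu Pv k; rewrite !mxE; apply: ideal_sub. Qed.

Lemma row_inD r (u v : 'rV_r) : row_in P u -> row_in P v -> row_in P (u + v).
Proof. by case: (idP) => _ add _ Pu Pv k; rewrite !mxE; apply: add. Qed.

Lemma row_inZ r a (v : 'rV_r) : row_in P v -> row_in P (a *: v).
Proof. by case: (idP) => _ _ mul Pv k; rewrite !mxE; apply: mul. Qed.

Lemma row_in_mul r s (v : 'rV_r) (M : 'M_(r, s)) :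
  row_in P v -> row_in P (v *m M).
Proof.
by move=> Pv k; rewrite !mxE; apply: ideal_sum => // i _; apply: ideal_mulr.
Qed.

End IdealFacts.

(** * Monomial ideals *)

Section MonomialIdeals.
Variables (K : fieldType) (n : nat).
Local Notation S := {mpoly K[n]}.
Implicit Types (p q : S) (m : 'X_{1..n}).

Lemma mcoeffXM m k p : ('X_[m] * p)@_(m + k) = p@_k.
Proof. by rewrite mulrC mcoeffMX. Qed.

Lemma mcoeffXM_eq0 m k p : ~~ (m <= k)%MM -> ('X_[m] * p)@_k = 0.
Proof.
move=> Nmk; rewrite mcoeffM big1 // => -[k1 k2] /= /eqP kE.
rewrite mcoeffX; case: eqP => [m_k1|_]; last by rewrite mul0r.
case/negP: Nmk; rewrite m_k1; apply/mnm_lepP => i.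
by move/mnmP/(_ i): kE; rewrite mnmE => ->; rewrite leq_addr.
Qed.

Lemma monomial_is_ideal (I : set S) : monomial_ideal I -> is_ideal I.
Proof. by case=> M ->; apply: ideal_gen_ideal. Qed.

(** In a combination sum c_i x^(m_i) of generators, each monomial of the support
    is divisible by one of the x^(m_i). *)
Lemma monomial_msupp (I : set S) p m :
  monomial_ideal I -> I p -> m \in msupp p -> I 'X_[m].
Proof.
case=> M -> Ip; apply: contraPP => NIm.
have idI := ideal_gen_ideal [set ('X_[m] : S) | m in M].
suff : p@_m = 0 by rewrite mcoeff_msupp => ->; rewrite eqxx.
case: Ip => k [c [g [Mg ->]]]; rewrite linear_sum big1 //= => i _.
have [m' Mm' <-] := Mg i; rewrite mulrC mcoeffXM_eq0 //.
apply/negP => le_m'm; apply: NIm; rewrite -(submK le_m'm) mpolyXD.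
by case: (idI) => _ _; apply; apply: mem_ideal_gen; exists m'.
Qed.

Lemma ideal_msupp (I : set S) p :
  is_ideal I -> (forall m, m \in msupp p -> I 'X_[m]) -> I p.
Proof.
move=> idI Ip; rewrite [p]mpolyE big_seq; apply: ideal_sum => // m mp.
by rewrite -mul_mpolyC; case: (idI) => _ _; apply; apply: Ip.
Qed.

(** The chain I + (x_i^N) becomes stationary, and x_i^N in I + (x_i^(N+1))
    forces x_i^N into I by comparing coefficients at x_i^N. *)
Lemma artinian_pow (I : set S) (i : 'I_n) :
  monomial_ideal I -> artinian_ideal I -> exists N, I 'X_[U_(i) *+ N].
Proof.
move=> monI artI; have idI := monomial_is_ideal monI.
pose J N := ideal_add I (ideal_gen [set ('X_[U_(i) *+ N] : S)]).
have idG N := ideal_gen_ideal [set ('X_[U_(i) *+ N] : S)].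
have [N0 |N /(_ N.+1 (leqnSn N)) JN] := artI J.
  split; first exact: ideal_add_ideal.
    by move=> p Ip; exists p => //; exists 0; [case: (idG N0) | rewrite addr0].
  move=> _ [p Ip [q Gq <-]]; exists p => //; exists q => //.
  apply: ideal_gen_min Gq => // _ ->; rewrite mulmS mpolyXD.
  by case: (idG N0) => _ _; apply; apply: mem_ideal_gen.
exists N.
have : J N 'X_[U_(i) *+ N].
  exists 0; first by case: idI.
  by exists 'X_[U_(i) *+ N]; [apply: mem_ideal_gen | rewrite add0r].
rewrite -JN => -[p Ip [_ [k [c [g [Ag ->]]]] pE]].
apply: (monomial_msupp monI Ip).
move/(congr1 (mcoeff (U_(i) *+ N))): pE; rewrite mcoeffD mcoeffX eqxx.
rewrite linear_sum big1 ?addr0 /= => [|j _].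
  by rewrite mcoeff_msupp => ->; apply: oner_neq0.
rewrite (Ag j) mulrC mcoeffXM_eq0 //; apply/mnm_lepP => /(_ i).
by rewrite !mulmnE mnm1E eqxx !mul1n ltnn.
Qed.

End MonomialIdeals.

(** * Ideals generated by variables *)

Section VariableIdeals.
Variables (K : fieldType) (n : nat).
Local Notation S := {mpoly K[n]}.
Implicit Types (p q : S) (m : 'X_{1..n}) (s t : seq 'I_n).

(** The ideal generated by the variables in s, described by its coefficients
    so that membership can be tested monomial by monomial. *)
Definition vars_ideal s : set S :=
  [set p | forall m, {in s, forall j, m j = 0%N} -> p@_m = 0].

Lemma vars_ideal_ideal s : is_ideal (vars_ideal s).
Proof.
split=> [m _|p q sp sq m m0|c p sp m m0]; first exact: mcoeff0.
  by rewrite mcoeffD sp // sq // addr0.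
rewrite mcoeffM big1 // => -[k1 k2] /= /eqP mE; rewrite sp ?mulr0 // => j sj.
move/mnmP/(_ j): mE; rewrite m0 // mnmE => /esym/eqP.
by rewrite addn_eq0 => /andP[_ /eqP].
Qed.

Lemma sub_vars_ideal s t : {subset s <= t} -> vars_ideal s `<=` vars_ideal t.
Proof. by move=> st p sp m m0; apply: sp => j /st /m0. Qed.

Lemma vars_ideal_nil p : vars_ideal [::] p -> p = 0.
Proof. by move=> p0; apply/mpolyP => m; rewrite mcoeff0 p0. Qed.

Lemma vars_ideal_var s i : i \in s -> vars_ideal s 'X_i.
Proof.
move=> si m m0; rewrite mcoeffX; case: eqP => // mE.
by move: (m0 i si); rewrite -mE mnm1E eqxx.
Qed.

(** The variables form a regular sequence in any order. *)
Lemma vars_ideal_reg s i p :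
  i \notin s -> vars_ideal s ('X_i * p) -> vars_ideal s p.
Proof.
move=> Nsi sip m m0; rewrite -(mcoeffXM U_(i)) sip // => j sj.
by rewrite mnmE m0 // addn0 mnm1E; case: eqP sj Nsi => // -> ->.
Qed.

(** The terms of p divisible by x_i, divided by x_i, make up q. *)
Lemma vars_ideal_cons s i p :
  vars_ideal (i :: s) p -> exists q, vars_ideal s (p - 'X_i * q).
Proof.
move=> sp; exists (\sum_(m <- msupp p | m i != 0%N) p@_m *: 'X_[m - U_(i)]).
move=> m m0; rewrite mcoeffB mulr_sumr linear_sum /=.
rewrite (eq_bigr (fun m' => p@_m' * (m' == m)%:R)) => [|m' m'i]; last first.
  by rewrite -scalerAr mcoeffZ -mpolyXD addmC submK ?lep1mP // mcoeffX.
have [mi|mi] := eqVneq (m i) 0%N.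
  rewrite sp => [|j]; last by rewrite inE => /predU1P[->|/m0].
  rewrite big1 ?subrr // => m' m'i; case: eqP => [mE|_]; last by rewrite mulr0.
  by rewrite mE mi eqxx in m'i.
apply/eqP; rewrite subr_eq0; apply/eqP.
have [mp|Nmp] := boolP (m \in msupp p); last first.
  rewrite memN_msupp_eq0 // big_seq_cond big1 // => m' /andP[m'p _].
  by case: eqP => [mE|_]; [rewrite -mE m'p in Nmp | rewrite mulr0].
rewrite -big_filter (bigD1_seq m) ?mem_filter ?mi ?filter_uniq ?msupp_uniq //=.
by rewrite eqxx mulr1 big1 ?addr0 // => m' /negPf ->; rewrite mulr0.
Qed.

Lemma row_vars_cons s i r (v : 'rV[S]_r) :
  row_in (vars_ideal (i :: s)) v ->
  exists y, row_in (vars_ideal s) (v - 'X_i *: y).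
Proof.
move=> sv; have [y sy] := choice (fun k => vars_ideal_cons (sv k)).
by exists (\row_k y k) => k; rewrite !mxE.
Qed.

Lemma row_vars_reg s i r (v : 'rV[S]_r) :
  i \notin s -> row_in (vars_ideal s) ('X_i *: v) -> row_in (vars_ideal s) v.
Proof.
by move=> Nsi sv k; apply: (vars_ideal_reg Nsi); move: (sv k); rewrite mxE.
Qed.

Lemma row_vars_sub s t r (v : 'rV[S]_r) :
  {subset s <= t} -> row_in (vars_ideal s) v -> row_in (vars_ideal t) v.
Proof. by move=> st sv k; apply: (sub_vars_ideal st (sv k)). Qed.

Lemma row_vars_scale s i r (v : 'rV[S]_r) :
  i \in s -> row_in (vars_ideal s) ('X_i *: v).
Proof.
move=> si k; rewrite mxE.
exact: ideal_mulr (vars_ideal_ideal s) (vars_ideal_var si).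
Qed.

End VariableIdeals.

(** * Homogeneous parts *)

Section HomogeneousParts.
Variables (K : fieldType) (n : nat).
Local Notation S := {mpoly K[n]}.
Implicit Types (p q : S) (m : 'X_{1..n}) (t g h : nat).

(** The part of degree t of p when p is the coefficient of a generator of
    degree g. Writing the condition as mdeg m + g = t, rather than
    mdeg m = t - g, gives zero when t < g. *)
Definition hpart t g p : S :=
  \sum_(m <- msupp p | (mdeg m + g == t)%N) p@_m *: 'X_[m].

Lemma mcoeff_hpart t g p m :
  (hpart t g p)@_m = if (mdeg m + g == t)%N then p@_m else 0.
Proof.
rewrite linear_sum /= big_mkcond /=.
under eq_bigr do rewrite mcoeffZ mcoeffX.
have [mp|Nmp] := boolP (m \in msupp p); last first.
  rewrite (memN_msupp_eq0 Nmp) if_same big_seq big1 // => m' m'p.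
  by case: (m' =P m) => [mE|_]; [rewrite -mE m'p in Nmp | rewrite mulr0 if_same].
rewrite (bigD1_seq m) ?msupp_uniq //= eqxx mulr1 big1 ?addr0 // => m'.
by move/negPf ->; rewrite mulr0 if_same.
Qed.

Lemma hpart_is_additive t g : zmod_morphism (hpart t g).
Proof.
move=> p q; apply/mpolyP => m; rewrite mcoeffB !mcoeff_hpart mcoeffB.
by case: ifP; rewrite ?subr0.
Qed.

HB.instance Definition _ t g :=
  GRing.isZmodMorphism.Build S S (hpart t g) (hpart_is_additive t g).

Lemma hpartM t g h p q :
  {in msupp q, forall m, (mdeg m + h)%N = g} ->
  hpart t h (p * q) = hpart t g p * q.
Proof.
move=> qg; apply/mpolyP => m; rewrite mcoeff_hpart !mcoeffM.
have termE (k : 'X_{1..n < (mdeg m).+1, (mdeg m).+1}) :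
    m == (k.1 + k.2)%MM -> (hpart t g p)@_k.1 * q@_k.2 =
      if (mdeg m + h == t)%N then p@_k.1 * q@_k.2 else 0.
  case: k => k1 k2 /= /eqP/(congr1 (@mdeg n)).
  rewrite mcoeff_hpart mdegD.
  have [k2q|Nk2q] := boolP (bmnm k2 \in msupp q); last first.
    by rewrite (memN_msupp_eq0 Nk2q) !mulr0 if_same.
  move=> degm; have -> : (mdeg m + h)%N = (mdeg k1 + g)%N.
    by rewrite [LHS](congr1 (addn^~ h) degm) -addnA qg.
  by case: ifP; rewrite ?mul0r.
by rewrite [RHS](eq_bigr _ termE); case: ifP => // _; rewrite big1.
Qed.

Lemma ideal_hpart (I : set S) t g p :
  (forall m, m \in msupp p -> I 'X_[m]) -> is_ideal I -> I (hpart t g p).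
Proof.
move=> Ip idI; apply: ideal_msupp => // m.
rewrite mcoeff_msupp mcoeff_hpart; case: ifP; last by rewrite eqxx.
by rewrite -mcoeff_msupp => _; apply: Ip.
Qed.

Lemma vars_ideal_hpart s t g p : vars_ideal s p -> vars_ideal s (hpart t g p).
Proof. by move=> sp m m0; rewrite mcoeff_hpart sp // if_same. Qed.

End HomogeneousParts.

(** * Lifting a socle monomial along a resolution *)

Section Resolutions.
Variables (K : fieldType) (n : nat) (I : set {mpoly K[n]}).
Variable F : free_complex K n.
Hypothesis monI : monomial_ideal I.
Hypothesis gradedF : graded_maps F.
Hypothesis exactF : exact_resolution I F.
Local Notation S := {mpoly K[n]}.

Lemma dmx_comp i (v : 'rV_(rk F i.+2)) : v *m dmx F i.+1 *m dmx F i = 0.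
Proof. by case: exactF => _ _ ex; apply/ex; exists v. Qed.

(** The cokernel of F_(i+1) -> F_i is an i-th syzygy module, and a sequence of
    at most i variables, regular on the ring, is regular on it as well. In
    elementary terms, a variable x is added to s as follows: if d v = x y
    modulo s, then d y = 0 modulo s because x is regular modulo s, so y = d z
    modulo s one step below, and v - x z is a cycle modulo s. *)
Lemma exact_mod_vars s : uniq s ->
  forall i (v : 'rV_(rk F i.+1)), (size s <= i)%N ->
    row_in (vars_ideal s) (v *m dmx F i) ->
  exists w, row_in (vars_ideal s) (v - w *m dmx F i.+1).
Proof.
elim: s => [_ i v _ v0|x s IHs /= /andP[Nsx uniqs] [//|i] v /= si sv].
  have [_ _ /(_ i v) [ex _]] := exactF.
  have [|w ->] := ex; last first.
    exists w => k; rewrite subrr mxE.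
    by case: (vars_ideal_ideal K ([::] : seq 'I_n)).
  by apply/rowP => k; rewrite [RHS]mxE; apply: vars_ideal_nil; apply: v0.
have ids := vars_ideal_ideal K s.
have [y sy] := row_vars_cons sv.
have [z sz] : exists z, row_in (vars_ideal s) (y - z *m dmx F i.+1).
  apply: IHs => //; apply: (row_vars_reg Nsx).
  move/(row_in_mul ids (dmx F i)): sy; rewrite mulmxBl dmx_comp sub0r.
  move/(row_inZ ids (-1)); rewrite scaleN1r opprK.
  by rewrite -scalemxAl.
have [w sw] : exists w, row_in (vars_ideal s) (v - 'X_x *: z - w *m dmx F i.+2).
  apply: IHs => //; first exact: ltnW.
  have -> : (v - 'X_x *: z) *m dmx F i.+1 =
    (v *m dmx F i.+1 - 'X_x *: y) + 'X_x *: (y - z *m dmx F i.+1).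
    by rewrite mulmxBl -scalemxAl scalerBr addrA subrK.
  by apply: row_inD => //; apply: row_inZ.
exists w; have -> : v - w *m dmx F i.+2 =
  (v - 'X_x *: z - w *m dmx F i.+2) + 'X_x *: z.
  by rewrite addrAC subrK.
have idxs := vars_ideal_ideal K (x :: s).
apply: row_inD => //; last by apply: row_vars_scale; rewrite mem_head.
by apply: row_vars_sub sw => j sj; rewrite inE sj orbT.
Qed.

Definition row_hpart t i (v : 'rV[S]_(rk F i)) : 'rV_(rk F i) :=
  \row_k hpart t (gdeg k) (v 0 k).

Lemma row_hpartB t i (u v : 'rV_(rk F i)) :
  row_hpart t (u - v) = row_hpart t u - row_hpart t v.
Proof. by apply/rowP => k; rewrite !mxE raddfB. Qed.

Lemma row_hpart_idem t i (v : 'rV_(rk F i)) :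
  row_hpart t (row_hpart t v) = row_hpart t v.
Proof.
apply/rowP => k; apply/mpolyP => m; rewrite !mxE !mcoeff_hpart.
by case: ifP => // ->.
Qed.

Lemma row_hpart_dmx t i (v : 'rV_(rk F i.+1)) :
  row_hpart t (v *m dmx F i) = row_hpart t v *m dmx F i.
Proof.
apply/rowP => l; rewrite !mxE raddf_sum; apply: eq_bigr => k _ /=.
by rewrite mxE; apply: hpartM => m; case: gradedF => _; apply.
Qed.

Lemma row_hpartX t i x (v : 'rV_(rk F i)) :
  row_hpart t.+1 ('X_x *: v) = 'X_x *: row_hpart t v.
Proof.
apply/rowP => k; rewrite !mxE.
apply/mpolyP => m; rewrite mcoeff_hpart.
have [xm|Nxm] := boolP (U_(x) <= m)%MM; last first.
  by rewrite !mcoeffXM_eq0 // if_same.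
rewrite -(submK xm) addmC !mcoeffXM mcoeff_hpart mdegD mdeg1.
by rewrite add1n addSn eqSS.
Qed.

Lemma row_vars_hpart s t i (v : 'rV_(rk F i)) :
  row_in (vars_ideal s) v -> row_in (vars_ideal s) (row_hpart t v).
Proof. by move=> sv k; rewrite mxE; apply: vars_ideal_hpart. Qed.

(** The induction that transports the socle element x^m of S/(I + (x_j)), step
    by step, along F. After the k variables in s have been used, u stands for
    a class of F_k / (s F_k + im d) that is killed by all variables but x_j and
    is nonzero even modulo x_j. When s contains all the variables but x_j, the
    last property says that u is not in the maximal ideal times F_(n-1), so one
    of its coordinates has a nonzero constant term. *)
Lemma socle_monomial_lift (m : 'X_{1..n}) (j : 'I_n) :
  m j = 0%N -> ~ I 'X_[m] -> (forall i, i != j -> I 'X_[U_(i) + m]) ->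
  forall s, uniq (j :: s) ->
  exists u : 'rV_(rk F (size s)),
    [/\ row_hpart (mdeg m + size s) u = u,
        forall i, i != j -> exists w,
          row_in (vars_ideal s) ('X_i *: u - w *m dmx F (size s))
      & ~ exists w, row_in (vars_ideal (j :: s)) (u - w *m dmx F (size s))].
Proof.
move=> mj NIm socm; elim=> [_ /=|x s IHs uniqs].
  have idI := monomial_is_ideal monI.
  have [aug_surj aug_ex _] := exactF.
  have [v Iv] := aug_surj 'X_[m].
  pose u := row_hpart (mdeg m) v.
  have Iu : I ('X_[m] - (u *m aug F) 0 0).
    have : I (hpart (mdeg m) 0 ('X_[m] - (v *m aug F) 0 0)).
      by apply: ideal_hpart => // k; apply: monomial_msupp.
    rewrite raddfB /=; congr (I (_ - _)).
      apply/mpolyP => k; rewrite mcoeff_hpart mcoeffX addn0.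
      by have [->|_] := eqVneq m k; rewrite ?eqxx // if_same.
    rewrite !mxE raddf_sum; apply: eq_bigr => k _ /=.
    rewrite mxE; apply: hpartM => k'.
    by rewrite addn0; case: gradedF => /(_ k)/dhomogP aug_hom _; apply: aug_hom.
  exists u; rewrite addn0; split.
  - exact: row_hpart_idem.
  - move=> i ij; have [w uE] : exists w, 'X_i *: u = w *m dmx F 0.
      apply/aug_ex; rewrite -scalemxAl mxE.
      have -> : 'X_i * (u *m aug F) 0 0 =
          'X_[U_(i) + m] - 'X_i * ('X_[m] - (u *m aug F) 0 0).
        by rewrite mulrBr -mpolyXD opprB addrC subrK.
      by apply: ideal_sub => //; [apply: socm | case: idI => _ _; apply].
    exists w => k; rewrite uE subrr mxE.
    by case: (vars_ideal_ideal K ([::] : seq 'I_n)).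
  (* Modulo the empty list, u = d w + x_j y, so x^m is in I + (x_j); the
     coefficient of x^m then puts x^m in I, since x_j does not divide it. *)
  case=> w ju; have [y y0] := row_vars_cons ju; apply: NIm.
  have uE : u = w *m dmx F 0 + 'X_j *: y.
    apply/rowP => k; apply/eqP; rewrite -subr_eq0 -(vars_ideal_nil (y0 k)).
    by rewrite !mxE opprD addrA.
  suff : I ('X_[m] - 'X_j * (y *m aug F) 0 0).
    move/(monomial_msupp monI); apply; rewrite mcoeff_msupp mcoeffB mcoeffX eqxx.
    by rewrite mcoeffXM_eq0 ?lep1mP ?mj // subr0 oner_neq0.
  have Iw : I ((w *m dmx F 0 *m aug F) 0 0) by apply/aug_ex; exists w.
  have -> : 'X_[m] - 'X_j * (y *m aug F) 0 0 =
     ('X_[m] - (u *m aug F) 0 0) + (w *m dmx F 0 *m aug F) 0 0.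
    rewrite uE mulmxDl -scalemxAl [(_ + 'X_j *: (y *m aug F)) 0 0]mxE.
    rewrite [('X_j *: (y *m aug F)) 0 0]mxE.
    by rewrite opprD addrA addrAC subrK.
  by case: idI => _ add _; apply: add.
(* u' is a homogeneous lift of x u along d, modulo s. *)
move: uniqs; rewrite /= inE negb_or => /andP[/andP[jx Nsj] /andP[Nsx uniqs]].
have [|u [uhom usoc Nu]] := IHs; first by rewrite /= Nsj.
have ids := vars_ideal_ideal K s.
have xj : x != j by rewrite eq_sym.
have [w0 xw0] := usoc x xj.
pose u' := row_hpart (mdeg m + (size s).+1) w0.
have xu : row_in (vars_ideal s) ('X_x *: u - u' *m dmx F (size s)).
  rewrite -[u in 'X_x *: u]uhom -row_hpartX -row_hpart_dmx -addnS -row_hpartB.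
  exact: row_vars_hpart.
exists u'; split.
- exact: row_hpart_idem.
- move=> i ij; have [y sy] := usoc i ij.
  have [|w sw] := @exact_mod_vars s uniqs (size s) ('X_i *: u' - 'X_x *: y) (leqnn _).
    have -> : ('X_i *: u' - 'X_x *: y) *m dmx F (size s) =
        'X_x *: ('X_i *: u - y *m dmx F (size s))
        - 'X_i *: ('X_x *: u - u' *m dmx F (size s)).
      rewrite mulmxBl -!scalemxAl !scalerBr !scalerA ['X_x * 'X_i]mulrC opprB.
      by rewrite [RHS]addrC [RHS]addrA addrNK.
    by apply: row_inB => //; apply: row_inZ.
  exists w; have -> : 'X_i *: u' - w *m dmx F (size s).+1 =
     ('X_i *: u' - 'X_x *: y - w *m dmx F (size s).+1) + 'X_x *: y.
    by rewrite addrAC subrK.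
  have idxs := vars_ideal_ideal K (x :: s).
  apply: row_inD => //; last by apply: row_vars_scale; rewrite mem_head.
  by apply: row_vars_sub sw => l sl; rewrite inE sl orbT.
(* If u' were zero in its quotient, u' = d w + x y modulo j :: s, then applying
   d would give x u = x d y modulo j :: s, and x can be cancelled. *)
case=> w jxw; apply: Nu.
have [|y jy] := @row_vars_cons _ _ (j :: s) x _ (u' - w *m dmx F (size s).+1).
  by apply: row_vars_sub jxw => l; rewrite !inE orbCA.
have idjs := vars_ideal_ideal K (j :: s).
exists y; apply: (@row_vars_reg _ _ _ x); first by rewrite inE negb_or xj.
have -> : 'X_x *: (u - y *m dmx F (size s)) =
    ('X_x *: u - u' *m dmx F (size s)) +
    (u' - w *m dmx F (size s).+1 - 'X_x *: y) *m dmx F (size s).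
  by rewrite !mulmxBl dmx_comp subr0 -scalemxAl addrA subrK scalerBr.
apply: row_inD => //; last exact: row_in_mul.
by apply: row_vars_sub xu => l sl; rewrite inE sl orbT.
Qed.

End Resolutions.

(** * Squares of general linear forms *)

Section GeneralLinearForm.
Variables (K : fieldType) (n : nat).
Local Notation S := {mpoly K[n]}.

(** A counterexample can be enlarged until it is a socle monomial modulo x_j,
    because degrees outside I are bounded. Its lift to F_(n-1) has a nonzero
    constant coordinate in degree n - 1 + mdeg m, so F_(n-1) has a generator of
    that degree. *)
Lemma monomial_missing_var (I : set S) d (m : 'X_{1..n}) (j : 'I_n) :
  (1 < n)%N -> monomial_ideal I -> artinian_ideal I ->
  almost_linear_resolution d I ->
  m j = 0%N -> (d <= mdeg m)%N -> I 'X_[m].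
Proof.
move=> n_gt1 monI artI [F [[gradF exF _] linF]].
have idI := monomial_is_ideal monI.
have [N IN] := choice (fun i => artinian_pow i monI artI).
pose B := (\sum_i N i)%N.
have degB (m' : 'X_{1..n}) : ~ I 'X_[m'] -> (mdeg m' <= B)%N.
  move=> NIm'; rewrite mdegE; apply: leq_sum => i _.
  rewrite leqNgt; apply/negP => lt_N; apply: NIm'.
  have le_m' : (U_(i) *+ N i <= m')%MM.
    apply/mnm_lepP => k; rewrite mulmnE mnm1E.
    by case: eqP => [<-|]; rewrite ?mul1n ?mul0n // ltnW.
  rewrite -(submK le_m') mpolyXD.
  by case: idI => _ _; apply.
move: {2}(B.+1) (leq_addl (mdeg m) B.+1) => k.
elim: k => [|k IHk] in m *.
  rewrite addn0 => lt_B _ _; apply: contrapT => /degB.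
  by rewrite leqNgt lt_B.
move=> le_B mj le_d; apply: contrapT => NIm.
have socm i : i != j -> I 'X_[U_(i) + m].
  move=> ij; apply: IHk.
  - by rewrite mdegD mdeg1 add1n addSnnS.
  - by rewrite mnmE mnm1E (negPf ij) mj.
  - by rewrite mdegD (leq_trans le_d) ?leq_addl.
pose s := rem j (enum 'I_n).
have ens : perm_eq (enum 'I_n) (j :: s) by apply: perm_to_rem; rewrite mem_enum.
have uniqs : uniq (j :: s) by rewrite -(perm_uniq ens) enum_uniq.
have size_s : size s = n.-1 by rewrite size_rem ?mem_enum // size_enum_ord.
have [u [uhom _ Nu]] := socle_monomial_lift monI gradF exF mj NIm socm uniqs.
apply: Nu; exists 0; rewrite mul0mx subr0 => k' m' m0.
have {m0} -> : m' = 0%MM.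
  by apply/mnmP => i; rewrite mnm0E m0 // -(perm_mem ens) mem_enum.
have betti0 : betti F (size s) (size s + mdeg m) = 0%N.
  by apply: linF => //; rewrite size_s leqnn andbT -ltnS prednK // ltnW.
apply/eqP; move: betti0; apply: contraPT => u0.
apply/eqP; rewrite -lt0n; apply/card_gt0P; exists k'; rewrite inE.
move: u0; rewrite -uhom mxE mcoeff_hpart mdeg0 add0n addnC.
by case: ifP => //; rewrite eqxx.
Qed.

(** With E i = rho^i t_i the recurrence says that the second difference of t
    vanishes modulo J, so t_i = t_0 + i (t_1 - t_0). Both ends being zero, so
    is t_1 as soon as e is invertible. The elements T i below are the relations
    t_i = i t_1, multiplied by rho^(i+1) to avoid inverses. *)
Lemma second_difference_ideal (R : comNzRingType) (J : set R) (E : nat -> R)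
    (rho r v : R) e :
  is_ideal J -> rho * r = 1 -> e%:R * v = 1 -> J (E 0%N) -> J (E e) ->
  (forall i, (i.+2 <= e)%N -> J (E i.+2 - 2 * rho * E i.+1 + rho ^+ 2 * E i)) ->
  forall i, (i <= e)%N -> J (E i).
Proof.
move=> idJ rho_r e_v J0 Je Jrec.
have [_ addJ mulJ] := idJ.
pose T i := rho * E i - i%:R * rho ^+ i * E 1%N.
have JT i : (i < e)%N -> J (T i) /\ J (T i.+1).
  elim: i => [_|i IHi lt_ie].
    rewrite /T expr0 mul0r mul0r subr0 expr1 mul1r subrr.
    by split; [apply: mulJ | case: idJ].
  have [JTi JTi1] := IHi (ltnW lt_ie); split => //.
  have -> : T i.+2 = rho * (E i.+2 - 2 * rho * E i.+1 + rho ^+ 2 * E i)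
     + ((2 * rho) * T i.+1 - rho ^+ 2 * T i).
    by rewrite /T !exprS -!natr1; ring.
  apply: addJ; first by apply: mulJ; apply: Jrec.
  by apply: ideal_sub => //; apply: mulJ.
have [e0|e_gt0] := posnP e.
  by move=> i; rewrite e0 leqn0 => /eqP ->.
have JE1 : J (E 1%N).
  have [_] : J (T e.-1) /\ J (T e.-1.+1) by apply: JT; rewrite prednK.
  rewrite prednK // => JTe.
  have -> : E 1%N = (v * r ^+ e) * (rho * E e - T e).
    rewrite /T subKr mulrA mulrACA [v * _]mulrC e_v mul1r -exprMn [r * _]mulrC.
    by rewrite rho_r expr1n mul1r.
  by apply: (mulJ); exact: ideal_sub idJ (mulJ _ _ Je) JTe.
move=> [//|i] lt_ie; have [_ JTi] := JT i lt_ie.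
have -> : E i.+1 = r * (T i.+1 + i.+1%:R * rho ^+ i.+1 * E 1%N).
  by rewrite /T subrK mulrA [r * _]mulrC rho_r mul1r.
by apply: (mulJ); apply: (addJ) => //; apply: mulJ.
Qed.

(** The monomials of x, y-degree e with a common cofactor satisfy modulo J the
    recurrence given by (a_x x + a_y y)^2, and those with no x or no y, at the two
    ends, are in J. *)
Lemma monomials_mod_square (J : set S) (a : 'I_n -> K) (x y : 'I_n) d :
  [pchar K] =i pred0 -> is_ideal J -> x != y -> a x != 0 -> a y != 0 ->
  J (linear_form a ^+ 2) ->
  (forall m, mdeg m = d -> m x = 0%N \/ m y = 0%N -> J 'X_[m]) ->
  forall m, mdeg m = d -> J 'X_[m].
Proof.
move=> charK idJ xy ax ay Jl Jxy m.
have [_ addJ mulJ] := idJ.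
move: {2}(m x + m y)%N (erefl (m x + m y)%N) => e.
elim/ltn_ind: e m => e IHe m mxy md.
have [e0|e_gt0] := posnP e.
  by apply: Jxy => //; left; apply/eqP; move: mxy; rewrite e0; case: (m x).
(* M i k is m with the exponents of x and y replaced by i and k. *)
pose al : 'X_{1..n} := [multinom (if (i == x) || (i == y) then 0 else m i)%N | i < n].
pose M i k := (al + U_(x) *+ i + U_(y) *+ k)%MM.
have Mx i k : M i k x = i.
  by rewrite !(mnmDE, mulmnE, mnm1E) mnmE eqxx [y == x]eq_sym (negPf xy) mul1n addn0.
have My i k : M i k y = k.
  by rewrite !(mnmDE, mulmnE, mnm1E) mnmE eqxx orbT (negPf xy) mul1n.
have mE : m = M (m x) (m y).
  apply/mnmP => i; have [->|ix] := eqVneq i x; first by rewrite Mx.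
  have [->|iy] := eqVneq i y; first by rewrite My.
  rewrite !(mnmDE, mulmnE, mnm1E) mnmE (negPf ix) (negPf iy).
  by rewrite [x == i]eq_sym (negPf ix) [y == i]eq_sym (negPf iy) !mul0n !addn0.
have degM i k : (mdeg (M i k) + e = i + k + d)%N.
  have -> : d = mdeg (M (m x) (m y)) by rewrite -mE.
  rewrite !mdegD !mdegMn !mdeg1 -mxy; lia.
have -> : 'X_[m] = 'X_[M (m x) (e - m x)%N] :> S by rewrite -mxy addKn -mE.
pose rho : S := (- (a y / a x))%:MP; pose r : S := (- (a x / a y))%:MP.
apply: (@second_difference_ideal _ J (fun i => 'X_[M i (e - i)%N] : S) rho r
          (e%:R^-1)%:MP e) => //; last by rewrite -mxy leq_addr.
- by rewrite -mpolyCM; congr (_%:MP); field; rewrite ax ay.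
- rewrite -[e%:R]mpolyC_nat -mpolyCM divff //.
  by rewrite pcharf0P // in charK; rewrite charK -lt0n.
- rewrite subn0; apply: Jxy; last by left; rewrite Mx.
  by apply/eqP; rewrite -(eqn_add2r e) degM add0n addnC.
- rewrite subnn; apply: Jxy; last by right; rewrite My.
  by apply/eqP; rewrite -(eqn_add2r e) degM addn0 addnC.
- move=> i lt_ie; pose k := (e - i.+2)%N; pose c := M i k.
  have -> : (e - i.+1 = k.+1)%N by rewrite /k; lia.
  have -> : (e - i = k.+2)%N by rewrite /k; lia.
  rewrite -/k.
  have Mstep i' k' z w :
      'X_[M i' k'] * 'X_z * 'X_w = 'X_[M i' k' + U_(z) + U_(w)] :> S.
    by rewrite !mpolyXD.
  have Mxx : 'X_[M i.+2 k] = 'X_[c] * 'X_x * 'X_x :> S.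
    rewrite Mstep; congr 'X_[_]; rewrite /c /M !mulmS; apply/mnmP => z.
    by rewrite !(mnmDE, mulmnE, mnm1E); lia.
  have Mxy : 'X_[M i.+1 k.+1] = 'X_[c] * 'X_x * 'X_y :> S.
    rewrite Mstep; congr 'X_[_]; rewrite /c /M !mulmS; apply/mnmP => z.
    by rewrite !(mnmDE, mulmnE, mnm1E); lia.
  have Myy : 'X_[M i k.+2] = 'X_[c] * 'X_y * 'X_y :> S.
    rewrite Mstep; congr 'X_[_]; rewrite /c /M !mulmS; apply/mnmP => z.
    by rewrite !(mnmDE, mulmnE, mnm1E); lia.
  pose lam : S := (a x)%:MP * 'X_x + (a y)%:MP * 'X_y.
  pose rest : S := \sum_(z | (z != x) && (z != y)) a z *: 'X_z.
  have lE : linear_form a = lam + rest.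
    rewrite /linear_form (bigD1 x) //= (bigD1 y) 1?eq_sym //= addrA /lam.
    by rewrite -!mul_mpolyC; congr (_ + _); apply: eq_bigl => z; rewrite andbC.
  have Jc z w : z != x -> z != y -> J ('X_[c] * 'X_z * 'X_w).
    move=> zx zy; rewrite Mstep; apply: (IHe _ _ _ (erefl _)).
      have stepE t : (M i k + U_(z) + U_(w))%MM t = (M i k t + (z == t) + (w == t))%N.
        by rewrite mnmDE mnmDE !mnm1E.
      rewrite !stepE Mx My (negPf zx) (negPf zy).
      by case: (w =P x) => [->|_]; rewrite ?eqxx ?(negPf xy) /k; [|case: (w == y)]; lia.
    have := degM i k; have : (i + k + 2 = e)%N by rewrite /k; lia.
    rewrite mdegD mdegD !mdeg1; move: (mdeg (M i k)) => D ke Dk.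
    by clear -ke Dk; lia.
  (* l^2 - lam^2 = rest (lam + l), a sum of terms with smaller degree in x, y. *)
  have Jrest : J ('X_[c] * rest * (lam + linear_form a)).
    rewrite /rest mulr_sumr mulr_suml; apply: ideal_sum => // z /andP[zx zy].
    have -> : 'X_[c] * (a z *: 'X_z) * (lam + linear_form a) = 
       (a z)%:MP * ('X_[c] * 'X_z * lam + 'X_[c] * 'X_z * linear_form a).
      by rewrite -mul_mpolyC; ring.
    apply: (mulJ); apply: (addJ).
      rewrite /lam mulrDr; apply: addJ; rewrite mulrCA; apply: mulJ; exact: Jc.
    rewrite mulr_sumr; apply: ideal_sum => // w _; rewrite -scalerAr -mul_mpolyC.
    by apply: mulJ; apply: Jc.
  have -> : 'X_[M i.+2 k] - 2 * rho * 'X_[M i.+1 k.+1] + rho ^+ 2 * 'X_[M i k.+2]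
     = ((a x)^-1)%:MP ^+ 2 *
       ('X_[c] * linear_form a ^+ 2 - 'X_[c] * rest * (lam + linear_form a)).
    have -> : rho = - (((a x)^-1)%:MP * (a y)%:MP) by rewrite /rho mpolyCN mulrC mpolyCM.
    rewrite Mxx Mxy Myy lE.
    have ax1 : ((a x)^-1)%:MP * (a x)%:MP = 1 :> S by rewrite -mpolyCM mulVf.
    transitivity ('X_[c] * ((((a x)^-1)%:MP * (a x)%:MP) * 'X_x
        + ((a x)^-1)%:MP * (a y)%:MP * 'X_y) ^+ 2); first by rewrite ax1; ring.
    by rewrite /lam; ring.
  apply: (mulJ); apply: ideal_sub => //; exact: mulJ.
Qed.

End GeneralLinearForm.

(** * Reduction to the monomials of degree d *)

(** The colon ideals of J by a factor q, and by a variable, allow the induction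
    on d to treat one factor from the maximal ideal at a time. *)
Lemma max_ideal_exp_sub (K : fieldType) (n d : nat) (J : set {mpoly K[n]}) :
  is_ideal J -> (forall m, mdeg m = d -> J 'X_[m]) ->
  ideal_exp max_ideal d `<=` J.
Proof.
elim: d J => [|d IHd] J idJ JX.
  move=> p _; rewrite -[p]mulr1; case: (idJ) => _ _; apply.
  by rewrite -mpolyX0; apply: JX; rewrite mdeg0.
have [J0 addJ mulJ] := idJ.
apply: ideal_gen_min => // _ [p max_p [q exp_q <-]].
pose colon r : set {mpoly K[n]} := [set s | J (r * s)].
have colon_ideal r : is_ideal (colon r).
  split=> [|s t Js Jt|c s Js]; rewrite /colon /= ?mulr0 //.
    by rewrite mulrDr; apply: addJ.
  by rewrite mulrCA; apply: mulJ.
rewrite mulrC; apply: (ideal_gen_min (colon_ideal q)) max_p => _ [i _ <-].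
rewrite /colon /= mulrC; apply: (IHd (colon 'X_i)) exp_q => // m md.
by rewrite /colon /= -mpolyXD; apply: JX; rewrite mdegD mdeg1 md.
Qed.

(** I is nonzero because it is artinian, and the support of any nonzero
    generator is reduced to the only monomial of degree d. *)
Lemma univariate_degree (K : fieldType) (d : nat) (I : set {mpoly K[1]}) m :
  monomial_ideal I -> artinian_ideal I -> generated_in_degree d I ->
  mdeg m = d -> I 'X_[m].
Proof.
move=> monI artI [G [[IE _] homG]] md.
have [N IN] := artinian_pow ord0 monI artI.
have [g Gg g0] : exists2 g, g \in G & g != 0.
  apply: contrapT => noG; move: IN; rewrite IE => -[k [c [g [Gg XE]]]].
  suff : ('X_[U_(ord0) *+ N] : {mpoly K[1]}) = 0.
    move/(congr1 (mcoeff (U_(ord0) *+ N))).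
    by rewrite mcoeffX eqxx mcoeff0 => /eqP; rewrite oner_eq0.
  rewrite XE big1 // => i _; have [->|gi0] := eqVneq (g i) 0; first exact: mulr0.
  by case: noG; exists (g i); first exact: Gg.
have := mlead_supp g0; have /dhomogP/(_ _ (mlead_supp g0)) degg := homG g Gg.
have -> : m = mlead g.
  apply/mnmP => i; rewrite (ord1 i); move: md (degg : mdeg (mlead g) = d).
  by rewrite !mdegE !big_ord1 => -> ->.
by apply: (monomial_msupp monI); rewrite IE; apply: mem_ideal_gen.
Qed.

Theorem theorem3p9 (K : fieldType) (n d : nat) (I : set {mpoly K[n]}) :
  [pchar K] =i pred0 ->
  (0 < n)%N ->
  artinian_ideal I ->
  monomial_ideal I ->
  generated_in_degree d I ->
  almost_linear_resolution d I ->
  for_general_linear_form (fun l : {mpoly K[n]} =>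
    ideal_exp max_ideal d `<=` ideal_add I (ideal_exp (ideal_gen [set l]) 2)).
Proof.
move=> charK n_gt0 artI monI genI linI.
exists [set a | exists2 f, [set \prod_(i < n) 'X_i] f & f.@[a] != 0]; split.
- by exists [set \prod_(i < n) 'X_i].
- exists (fun=> 1), (\prod_(i < n) 'X_i) => //.
  by rewrite rmorph_prod; apply/prodf_neq0 => i _; rewrite /= mevalXU oner_neq0.
move=> a [_ -> prod_a].
have {prod_a} a0 i : a i != 0.
  by move: prod_a; rewrite rmorph_prod => /prodf_neq0/(_ i isT); rewrite /= mevalXU.
set l := linear_form a; set J := ideal_add _ _.
have idI := monomial_is_ideal monI.
have idL : is_ideal (ideal_exp (ideal_gen [set l]) 2) by apply: ideal_gen_ideal.
have idJ : is_ideal J by apply: ideal_add_ideal.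
have IJ p : I p -> J p.
  by move=> Ip; exists p => //; exists 0; [case: idL | rewrite addr0].
apply: max_ideal_exp_sub => //.
have [n_le1|n_gt1] := leqP n 1.
  have n1 : n = 1%N by apply/eqP; rewrite eqn_leq n_le1.
  by subst n => m md; apply: IJ; apply: univariate_degree genI md.
apply: (monomials_mod_square (x := Ordinal n_gt0) (y := Ordinal n_gt1)
  charK idJ _ (a0 _) (a0 _)) => //.
  exists 0; first by case: idI.
  exists (l ^+ 2); last by rewrite add0r.
  apply: mem_ideal_gen; exists l; first exact: mem_ideal_gen.
  exists l => //; apply: mem_ideal_gen; exists l; first exact: mem_ideal_gen.
  by exists 1; rewrite ?mulr1.
move=> m md m0; apply: IJ.
by case: m0 => m0; apply: monomial_missing_var linI m0 _ => //; rewrite md.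
Qed.
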